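(* Let $K_0\in\mathbb R$ and $N\in(1,\infty)$. Let $\rho:(0,1)\to\mathbb R$, $z:(0,1)\to\mathbb R$ and $h_s:[0,1]\to\mathbb R$, $s\in(0,1)$, be functions such that: (A) $(0,1)\ni t\mapsto\rho(t)$ is locally Lipschitz and strictly positive. (B) For all $s\in(0,1)$, $h_s$ is a $\mathsf{CD}(K_0,N)$ density on $[0,1]$ satisfying $h_s(s)=1$ (in particular, it is locally Lipschitz continuous on $(0,1)$ and strictly positive there). (C) $(0,1)\ni t\mapsto z(t)$ is locally Lipschitz, and for any $\delta\in(0,1/2)$ there exists $C_\delta>0$ so that $$\frac{z(t)-z(s)}{t-s}\ge(1-C_\delta(t-s))\,|z(s)|\,|z(t)|\qquad\forall\,0<\delta\le s<t\le1-\delta<1$$ (in particular, $z'(t)\ge z^2(t)$ for a.e. $t\in(0,1)$). Assume that $$\frac{\rho(s)}{\rho(t)}=\frac{h_s(t)}{1+(t-s)z(t)}\qquad\text{for a.e. }t,s\in(0,1).$$ Then $$\frac1{\rho(t)}=L(t)\,Y(t)\qquad\forall t\in(0,1),$$ where $L$ is concave and $Y$ is a $\mathsf{CD}(K_0,N)$ density on $(0,1)$.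
   Context: For $K\in\mathbb R$, $\mathcal N\in(0,\infty)$ let $D_{K,\mathcal N}=\pi/\sqrt{K/\mathcal N}$ if $K>0$ and $+\infty$ otherwise. For $t\in[0,1]$ and $0<\theta<D_{K,\mathcal N}$, $\sigma^{(t)}_{K,\mathcal N}(\theta)=\frac{\sin(t\theta\sqrt{K/\mathcal N})}{\sin(\theta\sqrt{K/\mathcal N})}$ if $K>0$, $=t$ if $K=0$, $=\frac{\sinh(t\theta\sqrt{-K/\mathcal N})}{\sinh(\theta\sqrt{-K/\mathcal N})}$ if $K<0$; $\sigma^{(t)}_{K,\mathcal N}(0)=t$ and $\sigma^{(t)}_{K,\mathcal N}(\theta)=+\infty$ for $\theta\ge D_{K,\mathcal N}$. For $N\in(1,\infty)$, a $\mathsf{CD}(K,N)$ density on an interval $I\subset\mathbb R$ is a non-negative function $h$ on $I$ such that for all $x_0,x_1\in I$ and $t\in[0,1]$, $$h(tx_1+(1-t)x_0)^{\frac1{N-1}}\ge\sigma^{(t)}_{K,N-1}(|x_1-x_0|)\,h(x_1)^{\frac1{N-1}}+\sigma^{(1-t)}_{K,N-1}(|x_1-x_0|)\,h(x_0)^{\frac1{N-1}}.$$ *)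

(* Defs.v *)
From HB Require Import structures.
From mathcomp Require Import all_boot all_order all_algebra.
From mathcomp Require Import all_classical all_reals all_analysis.
Set Implicit Arguments.
Unset Strict Implicit.
Unset Printing Implicit Defensive.
Import Order.TTheory GRing.Theory Num.Theory.
Import numFieldNormedType.Exports.
Local Open Scope classical_set_scope.
Local Open Scope ring_scope.

Definition sinh (R : realType) (x : R) : R := (expR x - expR (- x)) / 2.

Definition diam_bound (R : realType) (K NN : R) : \bar R :=
  if 0 < K then (pi / Num.sqrt (K / NN))%:E else +oo%E.

(* sigma_coef K NN t theta is the distortion coefficient
   sigma^(t)_{K,NN}(theta), meant for NN > 0, 0 <= t <= 1 and theta >= 0. *)
Definition sigma_coef (R : realType) (K NN t theta : R) : \bar R :=
  if theta == 0 then t%:E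
  else if (diam_bound K NN <= theta%:E)%E then +oo%E
  else if 0 < K then
    (sin (t * theta * Num.sqrt (K / NN)) / sin (theta * Num.sqrt (K / NN)))%:E
  else if K == 0 then t%:E
  else
    (sinh (t * theta * Num.sqrt (- K / NN))
       / sinh (theta * Num.sqrt (- K / NN)))%:E.

(* The inequality is stated in \bar R because sigma_coef may be +oo; there
   +oo * 0 = 0, so two points at distance at least diam_bound K (N - 1) can only
   be zeros of h.  The values of h outside I are irrelevant. *)
Definition CD_density (R : realType) (K N : R) (I : interval R) (h : R -> R) :=
  (forall x, x \in I -> 0 <= h x) /\
  (forall x0 x1 t : R, x0 \in I -> x1 \in I -> t \in `[0, 1] ->
    let theta := `|x1 - x0| in
    let root y := h y `^ (N - 1)^-1 in
    (sigma_coef K (N - 1)%R t theta * (root x1)%:E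
     + sigma_coef K (N - 1)%R (1 - t)%R theta * (root x0)%:E
     <= (root (t * x1 + (1 - t) * x0))%:E)%E).

Definition concave_function (R : realType) (D : set R) (f : R -> R) :=
  convex_function (D : set (convex_lmodType R^o)) (fun x => - f x : R^o).

(* Main.v *)
Require Import Defs.
From HB Require Import structures.
From mathcomp Require Import all_boot all_order all_algebra.
From mathcomp Require Import all_classical all_reals all_analysis.
From mathcomp Require Import measurable_realfun ring lra.
Set Implicit Arguments.
Unset Strict Implicit.
Unset Printing Implicit Defensive.
Import Order.TTheory GRing.Theory Num.Theory.
Import numFieldNormedType.Exports.
Local Open Scope classical_set_scope.
Local Open Scope ring_scope.

(** Let [Z' = z] on (0,1), [L = exp (- Z)] and [Y = 1 / (rho L)].

    Hypothesis (C) bounds the lower right derivative of [z] by [z^2] from below,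
    so [z L = - L'] has nonnegative lower right derivatives and is nondecreasing:
    [L] is concave.  Its tangent at [t], of slope [- z(t) L(t)], gives
    [L(s) / L(t) <= 1 + (t - s) z(t)].

    Put [H_s(t) = rho(s) / rho(t) (1 + (t - s) z(t))].  The tangent inequality
    says exactly [Y(t) <= Y(s) H_s(t)], with equality at [t = s] as [H_s(s) = 1].
    For a.e. [s], [H_s = h_s] a.e., and [H_s] is continuous, hence a CD density;
    so for such a point [m] between [x0] and [x1], with y := Y^(1/(N-1)),
    [y(m) = y(m) H_m(m)^(1/(N-1)) >= sigma y(x1) + sigma' y(x0)].
    Both passages from almost every to every point translate [x0], [m], [x1] by a
    common small amount, which does not change the distortion coefficients. *)

(** * Almost-everywhere statements: sections, translations, limits *)

(** Tonelli: the sections of a measurable null cover [A] have measures integrating to zero, so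
    almost all of them are null. *)
Lemma ae_prod_ysection d1 d2 (T1 : measurableType d1) (T2 : measurableType d2)
    (R : realType) (m1 : {sigma_finite_measure set T1 -> \bar R})
    (m2 : {sigma_finite_measure set T2 -> \bar R}) (P : T1 * T2 -> Prop) :
  {ae (m1 \x m2)%E, forall p, P p} ->
  {ae m2, forall y, {ae m1, forall x, P (x, y)}}.
Proof.
move=> [A [mA A0 PA]].
have G0 : (\int[m2]_y `|(m1 \o ysection A) y| = 0)%E.
  under eq_integral => y _ do rewrite gee0_abs//.
  rewrite -indic_fubini_tonelli_GE// -indic_fubini_tonelli//.
  by rewrite indic_fubini_tonelli_FE// -A0.
move/(ae_eq_integral_abs m2 measurableT (measurable_fun_ysection m1 mA)) : G0.
apply: filterS => y /= /(_ Logic.I) Ay0.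
exists (ysection A y); split => //; first exact: measurable_ysection.
by move=> x /= nPxy; apply/set_mem; rewrite mem_ysection; apply/mem_set/PA.
Qed.

(** Uniqueness of Lebesgue measure: the image measure under a translation gives half-open intervals
    their length. *)
Lemma lebesgue_measure_shift (R : realType) (a : R) (A : set R) : measurable A ->
  pushforward (@lebesgue_measure R)
    ((fun x => x + a) : R -> measurableTypeR R) A = lebesgue_measure A.
Proof.
have ma : measurable_fun setT ((fun x => x + a) : measurableTypeR R -> measurableTypeR R).
  exact: measurable_funD.
move=> mA; pose f : {mfun measurableTypeR R >-> measurableTypeR R} :=
  @mfun_Sub _ _ (measurableTypeR R) (measurableTypeR R) _ (mem_set ma).
rewrite -[LHS]/(pushforward lebesgue_measure f A); apply/esym.
apply: lebesgue_measure_unique mA => /= _ [[b c]] _ <-; rewrite /pushforward.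
rewrite (_ : _ @^-1` _ = `]b - a, c - a]%classic); last first.
  by apply/seteqP; split => x /=; rewrite !in_itv/= ltrBlDr lerBrDr.
rewrite !lebesgue_measure_itv/= !lte_fin ltrD2r -!EFinB.
by rewrite opprB addrA subrK.
Qed.

Lemma ae_shift (R : realType) (a : R) (P : R -> Prop) :
  {ae (@lebesgue_measure R), forall x, P x} ->
  {ae (@lebesgue_measure R), forall x, P (x + a)}.
Proof.
move=> [A [mA A0 PA]].
have ma : measurable_fun setT ((fun x => x + a) : measurableTypeR R -> measurableTypeR R).
  exact: measurable_funD.
exists ((fun x => x + a) @^-1` A); split.
- by rewrite -[X in measurable X]setTI; exact: ma.
- by rewrite -A0 -(lebesgue_measure_shift a mA).
- by move=> x /= nP; exact: PA.
Qed.

(** A ball has positive measure, so it cannot lie inside a null set. *)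
Lemma ae_near_exists (R : realType) (a : R) (P Q : R -> Prop) :
  {ae (@lebesgue_measure R), forall x, P x} -> (\forall x \near a, Q x) ->
  exists x, P x /\ Q x.
Proof.
move=> [A [mA A0 PA]] /nbhs_ballP[e /= e0 aQ].
apply: contrapT => /forallNP nPQ.
have : (lebesgue_measure (ball a e) <= lebesgue_measure A)%E.
  apply: le_measure; rewrite ?inE//; first exact: measurable_ball.
  by move=> x /aQ Qx; apply: PA => Px; exact: (nPQ x).
rewrite A0 lebesgue_measure_ball; last exact: ltW.
by rewrite lee_fin leNgt pmulrn_lgt0// e0.
Qed.

Lemma ae_cvg_ge0 (R : realType) (a : R) (P : R -> Prop) (f : R -> R) :
  {ae (@lebesgue_measure R), forall x, P x} -> {for a, continuous f} ->
  (\forall x \near a, P x -> 0 <= f x) -> 0 <= f a.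
Proof.
move=> aeP cf Pf; rewrite leNgt; apply/negP => fa0.
have : \forall x \near a, f x < 0 by exact: (cvgr_lt _ cf).
move=> /filterI/(_ Pf)/(ae_near_exists aeP)[x [Px [fx0 Pfx]]].
by move: (Pfx Px); rewrite leNgt fx0.
Qed.

(** * Primitives, Dini derivatives, tangents and concavity *)

(** The primitive is the integral from the midpoint [c]. Since [f] may fail to be integrable up to
    [a], it is written as a difference of two integrals from a base [l x] below both [x] and [c];
    the choice of base cancels. *)
Lemma primitive_oo (R : realType) (a b : R) (f : R -> R) : a < b ->
  {in `]a, b[, continuous f} ->
  exists F : R -> R, forall x, x \in `]a, b[ -> is_derive x 1 F (f x).
Proof.
move=> ab cf; pose c := (a + b) / 2.
have /andP[ac cb] : a < c < b by have := mid_in_itvoo ab; rewrite in_itv.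
pose G l x := \int[lebesgue_measure]_(t in `[l, x]) f t.
have intf l u : a < l -> u < b ->
    lebesgue_measure.-integrable `[l, u] (EFin \o f).
  move=> al ub; apply: continuous_compact_integrable; first exact: segment_compact.
  apply/continuous_in_subspaceT => x /set_mem /=; rewrite in_itv/= => /andP[lx xu].
  by apply: cf; rewrite in_itv/= (lt_le_trans al lx) (le_lt_trans xu ub).
have GD l m x : a < l -> l <= m -> m <= x -> x < b -> G l x = G l m + G m x.
  move=> al lm mx xb; apply/eqP; rewrite addrC -subr_eq; apply/eqP.
  rewrite Rintegral_itvB ?bnd_simp//; last exact: intf.
  rewrite Rintegral_itv_obnd_cbnd//.
  apply: integrableS (intf l x al xb) => //.
  by apply: subset_itv; rewrite bnd_simp.
pose l x := (a + Num.min x c) / 2.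
exists (fun x => G (l x) x - G (l x) c) => x; rewrite in_itv/= => /andP[ax xb].
have amc y : a < y -> a < Num.min y c by move=> ay; rewrite lt_min ay.
have al y : a < y -> a < l y by move=> /amc /midf_lt[].
have lm y : a < y -> l y < Num.min y c by move=> /amc /midf_lt[].
(* A fixed base that stays below [l y] for all [y] near [x], so that the primitive is locally [G l0]
   minus a constant. *)
pose l0 := (a + l x) / 2.
have [al0 l0l] : a < l0 /\ l0 < l x by have [] := midf_lt (al _ ax).
have : derivable (G l0) x 1 /\ derive1 (G l0) x = f x.
  apply: (@continuous_FTC1_closed _ f l0 x ((x + b) / 2)).
  - by have [] := midf_lt xb.
  - by apply: intf => //; have [] := midf_lt xb.
  - by rewrite (lt_trans l0l)// (lt_le_trans (lm _ ax))// ge_min lexx.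
  - by apply: cf; rewrite in_itv/= ax.
move=> [G'x <-]; rewrite derive1E.
suff GG : \near x, G l0 x - G l0 c = G (l x) x - G (l x) c.
  apply: (near_eq_is_derive GG).
  rewrite -[X in is_derive _ _ _ X]subr0.
  exact: (is_deriveB (derivableP G'x) (is_derive_cst _ _ _)).
near=> y.
have [ay yb lxy] : [/\ a < y, y < b & l x < y].
  split; near: y; [exact: lt_nbhsr|exact: lt_nbhsl|apply: lt_nbhsr].
  by rewrite (lt_le_trans (lm _ ax))// ge_min lexx.
have l0ly : l0 < l y.
  rewrite /l0 ltr_pM2r// ltrD2l lt_min lxy (lt_le_trans (lm _ ax))//.
  by rewrite ge_min lexx orbT.
have lyy : l y <= y by rewrite (le_trans (ltW (lm _ ay)))// ge_min lexx.
have lyc : l y <= c by rewrite (le_trans (ltW (lm _ ay)))// ge_min lexx orbT.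
by rewrite (GD l0 (l y) y)// ?ltW// (GD l0 (l y) c)// ?ltW// opprD addrACA subrr add0r.
Unshelve. all: by end_near.
Qed.

(** After adding a small slope [k], the function [g] increases strictly to the right of every point
    before [y], so its maximum on [[x, y]] is attained at [y]. *)
Lemma nondecreasing_lower_dini (R : realType) (a b : R) (f : R -> R) :
  {in `]a, b[, continuous f} ->
  (forall x, x \in `]a, b[ -> forall e, 0 < e ->
     \forall y \near x^'+, - e * (y - x) <= f y - f x) ->
  {in `]a, b[ &, {homo f : x y / x <= y}}.
Proof.
move=> cf df x y; rewrite !in_itv/= => /andP[ax xb] /andP[ay yb].
rewrite le_eqVlt => /predU1P[->//|xy]; apply/ler_addgt0Pr => e e0.
(* With this slope the perturbation contributes exactly [e] between [x] and [y]. *)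
pose k := e / (y - x); have k0 : 0 < k by rewrite divr_gt0// subr_gt0.
pose g t := f t + k * t.
have cg : {within `[x, y], continuous g}.
  apply/continuous_in_subspaceT => t /set_mem /=; rewrite in_itv/= => /andP[xt ty].
  apply: cvgD; first by apply: cf; rewrite in_itv/= (lt_le_trans ax)// (le_lt_trans ty).
  by apply: cvgM; [exact: cvg_cst|exact: cvg_id].
have [c] := EVT_max (ltW xy) cg; rewrite in_itv/= => /andP[xc cy] gc.
suff cyE : c = y.
  have := gc x; rewrite in_itv/= lexx (ltW xy) => /(_ isT); rewrite cyE /g.
  rewrite -lerBrDr -addrA -mulrBr => /le_trans; apply.
  by rewrite lerD2l /k divfK// subr_eq0 gt_eqF.
apply/eqP; rewrite eq_le cy leNgt; apply/negP => cy'.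
have cab : c \in `]a, b[ by rewrite in_itv/= (lt_le_trans ax)// (le_lt_trans cy).
have k20 : 0 < k / 2 by rewrite divr_gt0.
(* At a maximum point [c < y], the tolerance [k / 2] still leaves [g] a growth of at least
   [k / 2 * (t - c)], which is absurd. *)
have : \forall t \near c^'+, False; last first.
  by move=> /filter_ex[].
near=> t.
have ct : c < t by near: t; exact: nbhs_right_gt.
have ty : t <= y by near: t; exact: nbhs_right_le.
have ft : - (k / 2) * (t - c) <= f t - f c by near: t; exact: df.
have := gc t; rewrite in_itv/= ty (le_trans xc (ltW ct)) => /(_ isT); rewrite /g.
have kct : 0 < k * (t - c) by rewrite mulr_gt0// subr_gt0.
move: ft kct; lra.
Unshelve. all: by end_near.
Qed.

Lemma nonincreasing_derive_tangent (R : realType) (a b : R) (f df : R -> R) :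
  (forall x, x \in `]a, b[ -> is_derive x 1 f (df x)) ->
  {in `]a, b[ &, {homo df : x y /~ x <= y}} ->
  {in `]a, b[ &, forall t s, f s <= f t + df t * (s - t)}.
Proof.
move=> fD dfN t s tab sab.
have cf x y : x \in `]a, b[ -> y \in `]a, b[ -> {within `[x, y], continuous f}.
  rewrite !in_itv/= => /andP[ax _] /andP[_ yb].
  apply/continuous_in_subspaceT => u /set_mem /=; rewrite in_itv/= => /andP[xu uy].
  apply/differentiable_continuous/derivable1_diffP.
  have /fD[]// : u \in `]a, b[ by rewrite in_itv/= (lt_le_trans ax)// (le_lt_trans uy).
have fD' x y u : x \in `]a, b[ -> y \in `]a, b[ -> u \in `]x, y[ ->
    u \in `]a, b[.
  rewrite !in_itv/= => /andP[ax _] /andP[_ yb] /andP[xu uy].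
  by rewrite (lt_trans ax)// (lt_trans uy).
have [ts|st|->] := ltgtP t s; last by rewrite subrr mulr0 addr0.
- have [c ctsI fE] := MVT ts (fun x xts => fD x (fD' _ _ _ tab sab xts)) (cf _ _ tab sab).
  have cab := fD' _ _ _ tab sab ctsI.
  move: ctsI; rewrite in_itv/= => /andP[tc cs].
  have := dfN _ _ cab tab (ltW tc); rewrite -(ler_pM2r (_ : 0 < s - t)) ?subr_gt0//.
  by move: fE; lra.
- have [c ctsI fE] := MVT st (fun x xts => fD x (fD' _ _ _ sab tab xts)) (cf _ _ sab tab).
  have cab := fD' _ _ _ sab tab ctsI.
  move: ctsI; rewrite in_itv/= => /andP[sc ct].
  have := dfN _ _ tab cab (ltW ct); rewrite -(ler_pM2r (_ : 0 < t - s)) ?subr_gt0//.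
  by move: fE; lra.
Qed.

Lemma conv_itvoo (R : realType) (a b x y t : R) :
  x \in `]a, b[ -> y \in `]a, b[ -> 0 <= t -> t <= 1 ->
  t * x + (1 - t) * y \in `]a, b[.
Proof.
rewrite !in_itv/= => /andP[ax xb] /andP[ay yb] t0 t1; set m := _ + _.
have mx : m - x = (1 - t) * (y - x) by rewrite /m; ring.
have my : y - m = t * (y - x) by rewrite /m; ring.
have [xy|/ltW yx] := leP x y.
  rewrite (lt_le_trans ax) -1?subr_ge0 ?mx ?mulr_ge0 ?subr_ge0//=.
  by rewrite (le_lt_trans _ yb)// -subr_ge0 my mulr_ge0 ?subr_ge0.
rewrite (lt_le_trans ay) -1?subr_le0 ?my ?mulr_ge0_le0 ?subr_le0//=.
by rewrite (le_lt_trans _ xb)// -subr_le0 mx mulr_ge0_le0 ?subr_ge0 ?subr_le0.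
Qed.

(** Average the tangent inequalities at the barycentre [m]: the first-order terms cancel. *)
Lemma tangent_concave (R : realType) (a b : R) (f df : R -> R) :
  {in `]a, b[ &, forall t s, f s <= f t + df t * (s - t)} ->
  concave_function `]a, b[%classic f.
Proof.
move=> ft t x y /set_mem xab /set_mem yab.
rewrite -[conv t x y]/(t%:num * x + (1 - t%:num) * y : R).
rewrite -[leRHS]/(t%:num * - f x + (1 - t%:num) * - f y : R).
have t0 : 0 <= t%:num by []. have t1 : 0 <= 1 - t%:num by rewrite subr_ge0.
set m := t%:num * x + _.
have mab : m \in `]a, b[ by apply: conv_itvoo => //; rewrite -subr_ge0.
have := lerD (ler_wpM2l t0 (ft _ _ mab xab)) (ler_wpM2l t1 (ft _ _ mab yab)).
have -> : t%:num * (f m + df m * (x - m)) + (1 - t%:num) * (f m + df m * (y - m))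
    = f m by rewrite /m; ring.
by rewrite !mulrN -opprD lerN2.
Qed.

(** * The Riccati inequality for [z] *)

Lemma nondecreasing_riccati (R : realType) (z L : R -> R) :
  {in `]0, 1[, continuous z} ->
  (forall x : R, x \in `]0, 1[ -> 0 < L x) ->
  (forall x : R, x \in `]0, 1[ -> is_derive x 1 L (- (z x * L x))) ->
  (forall delta : R, delta \in `]0, 2^-1[ ->
     exists2 C : R, 0 < C &
       forall s t : R, delta <= s -> s < t -> t <= 1 - delta ->
         (1 - C * (t - s)) * (`|z s| * `|z t|) <= (z t - z s) / (t - s)) ->
  {in `]0, 1[ &, {homo (fun x : R => z x * L x) : x y / x <= y}}.
Proof.
move=> cz L0 LD z_ineq.
have cL : {in `]0, 1[, continuous L}.
  move=> x /LD[] /derivable1_diffP /differentiable_continuous.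
  by [].
apply: nondecreasing_lower_dini => [x x01|p p01 e e0].
  by apply: cvgM; [exact: cz|exact: cL].
have /is_derive1_caratheodory[k [kE ck kp]] := LD _ p01.
(* Half the distance to the endpoints: [p] and the points just right of it lie in [[d, 1 - d]],
   where one constant [C] serves. *)
pose d := Num.min p (1 - p) / 2.
have /andP[p0 p1] : 0 < p < 1 by move: p01; rewrite in_itv.
have d0 : 0 < d by rewrite divr_gt0// lt_min p0 subr_gt0.
have dp2 : d <= p / 2 by rewrite ler_pM2r// ge_min lexx.
have d1p2 : d <= (1 - p) / 2 by rewrite ler_pM2r// ge_min lexx orbT.
have dp : d <= p by lra.
have d01 : d \in `]0, 2^-1[ by rewrite in_itv/= d0/=; lra.
have [C C0 zC] := z_ineq _ d01.
(* [Phi y * (y - p)] bounds the increment of [z * L] from below, with [k] the Caratheodory slope of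
   [L] at [p]. As [k p = - (z p * L p)], the two terms cancel at [p]. *)
pose Phi y := (1 - C * (y - p)) * (`|z p| * `|z y|) * L y + z p * k y.
have cPhi : {for p, continuous Phi}.
  have cyp : {for p, continuous (fun y : R => y - p)}.
    by apply: cvgB; [exact: cvg_id|exact: cvg_cst].
  apply: cvgD; last by apply: cvgM; [exact: cvg_cst|exact: ck].
  apply: cvgM; last exact: cL.
  apply: cvgM; first by apply: cvgB; [|apply: cvgM => //]; exact: cvg_cst.
  by apply: cvgM; [exact: cvg_cst|apply: cvg_norm; exact: cz].
have Phip : Phi p = 0.
  rewrite /Phi kp subrr mulr0 subr0 mul1r -normrM ger0_norm -?expr2 ?sqr_ge0//.
  ring.
near=> y.
have py : p < y by near: y; exact: nbhs_right_gt.
have Phiy : - e <= Phi y.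
  near: y; apply: cvg_within; apply: (cvgr_ge _ cPhi).
  by rewrite Phip oppr_lt0.
have y1d : y <= 1 - d by near: y; apply: nbhs_right_le; lra.
have y01 : y \in `]0, 1[ by rewrite in_itv/=; apply/andP; split; lra.
have := zC _ _ dp py y1d; rewrite ler_pdivlMr ?subr_gt0// => zpy.
have := kE y; rewrite /= => Ly.
have Ly0 := L0 _ y01.
have := ler_wpM2r (ltW Ly0) zpy.
have := ler_wpM2r (_ : 0 <= y - p) Phiy; rewrite subr_ge0 (ltW py) => /(_ isT).
move=> h1 h2; apply: (le_trans h1).
have -> : z y * L y - z p * L p = (z y - z p) * L y + z p * (L y - L p) by ring.
rewrite Ly /Phi.
move: h2; lra.
Unshelve. all: by end_near.
Qed.

(** * Continuity, distortion coefficients, and inequalities up to translation *)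

Lemma locally_lipschitz_continuous (R : realType) (a b : R) (f : R -> R) :
  [locally [lipschitz f t | t in (`]a, b[%classic : set R)]] ->
  {in `]a, b[, continuous f}.
Proof.
move=> lipf x xab.
have [M [_ /(_ (M + 1))]] := lipf (x, x) (conj xab xab).
rewrite ltrDl => /(_ ltr01) /nbhs_ballP[d /= d0 fM].
have e1 : M + 1 <= `|M + 1| + 1 by rewrite (le_trans (ler_norm _))// lerDl.
(* [M + 1] may be nonpositive; this larger Lipschitz constant can be divided by. *)
have k0 : 0 < `|M + 1| + 1 by rewrite ltr_wpDl.
apply/cvgrPdist_lt => e e0; near=> y.
have yab : y \in `]a, b[ by near: y; exact: near_in_itvoo.
have xyd : ball x d y by near: y; apply/nbhs_ballP; exists d.
have := fM (x, y) (conj (ballxx _ d0) xyd) (conj xab yab).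
move=> /= /le_lt_trans; apply.
rewrite (le_lt_trans (ler_wpM2r _ e1))// mulrC -ltr_pdivlMr//.
near: y; apply/nbhs_ballP; exists (e / (`|M + 1| + 1)) => //=.
exact: divr_gt0.
Unshelve. all: by end_near.
Qed.


Lemma continuous_powR (R : realType) (f : R -> R) (p x : R) :
  0 < f x -> {for x, continuous f} ->
  {for x, continuous (fun y => f y `^ p)}.
Proof.
move=> fx0 cf; apply: (@continuous_comp _ _ _ f (@powR R ^~ p)) => //.
apply/differentiable_continuous/derivable1_diffP.
by apply: derivable_powR; rewrite in_itv/= fx0.
Qed.

Lemma sinh_ge0 (R : realType) (x : R) : 0 <= x -> 0 <= sinh x.
Proof.
by move=> x0; rewrite divr_ge0// subr_ge0 ler_expR (le_trans _ x0)// oppr_le0.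
Qed.

(** For [K > 0], a [theta] below the diameter bound keeps both arguments of [sin] in [[0, pi]]. *)
Lemma sigma_coef_ge0 (R : realType) (K NN t theta : R) : 0 < NN ->
  0 <= t -> t <= 1 -> 0 <= theta -> (0 <= sigma_coef K NN t theta)%E.
Proof.
move=> NN0 t0 t1 th0; rewrite /sigma_coef /diam_bound.
case: ifPn => // _; case: (ltP 0 K) => [K0|K0]; last first.
  rewrite leye_eq/=; case: ifPn => // _; rewrite lee_fin.
  by rewrite divr_ge0// sinh_ge0// !mulr_ge0// sqrtr_ge0.
case: ifPn; first by rewrite leey.
have k0 : 0 < Num.sqrt (K / NN) by rewrite sqrtr_gt0 divr_gt0.
rewrite lee_fin -ltNge ltr_pdivlMr// => thpi; rewrite lee_fin divr_ge0//.
- rewrite sin_ge0_pi// !mulr_ge0 ?(ltW k0)//=.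
  by rewrite (le_trans _ (ltW thpi))// ler_pM2r// ler_piMl.
- by rewrite sin_ge0_pi// mulr_ge0 ?(ltW k0)//= ltW.
Qed.

(* The common translation [e] of the three points leaves their distances, hence
   the coefficients [a] and [b], unchanged. *)
Lemma ae_shifted_le (R : realType) (a b : \bar R) (u : R -> R) (P : R -> Prop)
    (x0 x1 m : R) : (0 <= a)%E -> (0 <= b)%E ->
  {ae (@lebesgue_measure R), forall x, P x} ->
  {in `]0, 1[, continuous u} -> (forall x : R, x \in `]0, 1[ -> 0 < u x) ->
  x0 \in `]0, 1[ -> x1 \in `]0, 1[ -> m \in `]0, 1[ ->
  (forall e, x0 + e \in `]0, 1[ -> x1 + e \in `]0, 1[ -> m + e \in `]0, 1[ ->
    P (x0 + e) -> P (x1 + e) -> P (m + e) ->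
    (a * (u (x1 + e))%:E + b * (u (x0 + e))%:E <= (u (m + e))%:E)%E) ->
  (a * (u x1)%:E + b * (u x0)%:E <= (u m)%:E)%E.
Proof.
move=> a0 b0 aeP cu u0 x0I x1I mI le_u.
have near_shift (x : R) : x \in `]0, 1[ -> \forall e \near (0 : R), x + e \in `]0, 1[.
  move=> xI; have c0 : x + e @[e --> (0 : R)] --> x.
    by rewrite -[X in _ --> X]addr0; apply: cvgD; [exact: cvg_cst|exact: cvg_id].
  exact: c0 _ (near_in_itvoo xI).

(* Translation invariance makes almost every [e] good for the three points at once. *)
pose Q e := [/\ P (x0 + e), P (x1 + e) & P (m + e)].
have aeQ : {ae (@lebesgue_measure R), forall e, Q e}.
  have aeS x := ae_shift x aeP.
  have aeF := ae_filter_ringOfSetsType (@lebesgue_measure R).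
  apply: filterS3 (aeS x0) (aeS x1) (aeS m) => e P0 P1 Pm.
  by split; rewrite addrC.
have nearI : \forall e \near (0 : R),
    [/\ x0 + e \in `]0, 1[, x1 + e \in `]0, 1[ & m + e \in `]0, 1[].
  near=> e; split; near: e; exact: near_shift.
have [e [[Px0 Px1 Pm] [x0eI x1eI meI]]] := ae_near_exists aeQ nearI.
have le_e := le_u e x0eI x1eI meI Px0 Px1 Pm.
(* One good translation already forces [a] and [b] to be finite: as [u > 0], an infinite coefficient
   would make the left side [+oo]. *)
have [ua ub] : (0 < (u (x1 + e))%:E /\ 0 < (u (x0 + e))%:E)%E.
  by rewrite !lte_fin !u0.
have afin : a \is a fin_num.
  rewrite ge0_fin_numE// ltNge leye_eq; apply/negP => /eqP ay.
  move: le_e; rewrite ay gt0_mulye// addye ?leye_eq//.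
  by rewrite gt_eqF// (lt_le_trans ltNy0)// mule_ge0// ltW.
have bfin : b \is a fin_num.
  rewrite ge0_fin_numE// ltNge leye_eq; apply/negP => /eqP bY.
  move: le_e; rewrite bY gt0_mulye// addey ?leye_eq//.
  by rewrite gt_eqF// (lt_le_trans ltNy0)// mule_ge0// ltW.
rewrite -(fineK afin) -(fineK bfin) -!EFinM -EFinD lee_fin -subr_ge0.
have cshift (x : R) : x \in `]0, 1[ ->
    {for 0, continuous (fun e : R => u (x + e))}.
  move=> xI; apply: continuous_comp.
    by apply: cvgD; [exact: cvg_cst|exact: cvg_id].
  by rewrite /= addr0; exact: cu.
(* The gap in the inequality as a function of the translation: nonnegative for almost every small
   [e] and continuous at 0, hence nonnegative at 0. *)
pose F e := u (m + e) - (fine a * u (x1 + e) + fine b * u (x0 + e)).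
have cF : {for 0, continuous F}.
  apply: cvgB; first exact: cshift.
  by apply: cvgD; (apply: cvgM; [exact: cvg_cst|exact: cshift]).
have := ae_cvg_ge0 aeQ cF; rewrite /F !addr0; apply.
near=> t => -[Pt0 Pt1 Ptm].
have [t0I t1I tmI] : [/\ x0 + t \in `]0, 1[, x1 + t \in `]0, 1[ & m + t \in `]0, 1[].
  by near: t.
have := le_u t t0I t1I tmI Pt0 Pt1 Ptm.
by rewrite subr_ge0 -lee_fin EFinD !EFinM !fineK.
Unshelve. all: by end_near.
Qed.

(** * The factorisation of [1 / rho] into a concave function and a density *)

Theorem theorem12p3 (R : realType) (K0 N : R) (hN : 1 < N)
  (rho z : R -> R) (h : R -> R -> R)
  (rho_lip : [locally [lipschitz rho t | t in (`]0, 1[%classic : set R)]])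
  (rho_pos : forall t : R, t \in `]0, 1[ -> 0 < rho t)
  (h_CD : forall s : R, s \in `]0, 1[ ->
     CD_density K0 N `[0, 1] (h s) /\ h s s = 1)
  (z_lip : [locally [lipschitz z t | t in (`]0, 1[%classic : set R)]])
  (z_ineq : forall delta : R, delta \in `]0, 2^-1[ ->
     exists2 C : R, 0 < C &
       forall s t : R, delta <= s -> s < t -> t <= 1 - delta ->
         (1 - C * (t - s)) * (`|z s| * `|z t|) <= (z t - z s) / (t - s))
  (rho_h : {ae (@lebesgue_measure R \x @lebesgue_measure R)%E,
     forall p, p.1 \in `]0, 1[ -> p.2 \in `]0, 1[ ->
       let t := p.1 in let s := p.2 in
       rho s / rho t = h s t / (1 + (t - s) * z t)}) :
  exists L Y : R -> R,
    [/\ concave_function `]0, 1[%classic L,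
        CD_density K0 N `]0, 1[ Y &
        forall t : R, t \in `]0, 1[ -> 1 / rho t = L t * Y t].
Proof.
have rho_c := locally_lipschitz_continuous rho_lip.
have z_c := locally_lipschitz_continuous z_lip.
have [Z ZD] := primitive_oo (@ltr01 R) z_c.
pose L x := expR (- Z x).
have L0 x : 0 < L x by exact: expR_gt0.
have LD (x : R) : x \in `]0, 1[ -> is_derive x 1 L (- (z x * L x)).
  move=> /ZD Zx; rewrite mulrC -mulrN.
  exact: (@is_derive1_comp _ expR (fun y => - Z y)).
have L_c : {in `]0, 1[, continuous L}.
  by move=> x /LD[+ _] => /derivable1_diffP /differentiable_continuous.
have zL_mono := nondecreasing_riccati z_c (fun x _ => L0 x) LD z_ineq.
have L_tan : {in `]0, 1[ &, forall t s, L s <= L t + - (z t * L t) * (s - t)}.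
  apply: nonincreasing_derive_tangent => // x y x01 y01 xy.
  by rewrite lerN2; exact: zL_mono.
have L_ratio s t : s \in `]0, 1[ -> t \in `]0, 1[ ->
    L s / L t <= 1 + (t - s) * z t.
  move=> sI tI; rewrite ler_pdivrMr//; have := L_tan t s tI sI; lra.
(* The tangent bound keeps the denominators of [rho_h] positive, so they can be cleared. *)
have den_gt0 s t : s \in `]0, 1[ -> t \in `]0, 1[ -> 0 < 1 + (t - s) * z t.
  by move=> sI tI; rewrite (lt_le_trans _ (L_ratio s t sI tI))// divr_gt0.
have N10 : 0 < N - 1 by rewrite subr_gt0.
pose al := (N - 1)^-1; have al0 : 0 < al by rewrite invr_gt0.
pose H s t := rho s / rho t * (1 + (t - s) * z t).
have H0 s t : s \in `]0, 1[ -> t \in `]0, 1[ -> 0 < H s t.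
  by move=> sI tI; rewrite mulr_gt0 ?den_gt0// divr_gt0// rho_pos.
have H_c s : s \in `]0, 1[ -> {in `]0, 1[, continuous (H s)}.
  move=> sI t tI; apply: cvgM.
    by apply: cvgM; [exact: cvg_cst|apply: cvgV; [rewrite gt_eqF ?rho_pos|exact: rho_c]].
  apply: cvgD; first exact: cvg_cst.
  apply: cvgM; last exact: z_c.
  by apply: cvgB; [exact: cvg_id|exact: cvg_cst].
pose y t := (rho t * L t)^-1 `^ al.
have Y0 t : t \in `]0, 1[ -> 0 < (rho t * L t)^-1.
  by move=> tI; rewrite invr_gt0 mulr_gt0 ?rho_pos.
have y_c : {in `]0, 1[, continuous y}.
  move=> t tI; apply: (@continuous_powR _ (fun x => (rho x * L x)^-1)).
    exact: Y0.
  apply: cvgV; first by rewrite gt_eqF// mulr_gt0 ?rho_pos.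
  by apply: cvgM; [exact: rho_c|exact: L_c].
(* In [rho_h] the second coordinate is the parameter [s]: for almost every [s], the identity holds
   for almost every [t]. *)
have H_good := ae_prod_ysection rho_h.
exists L, (fun t => (rho t * L t)^-1); split.
- exact: tangent_concave L_tan.
- split=> [x xI|x0 x1 t x0I x1I t01]; first exact: ltW (Y0 _ xI).
  rewrite /= -/al -/(y x1) -/(y x0) -/(y (t * x1 + (1 - t) * x0)).
  have /andP[t0 t1] : 0 <= t <= 1 by move: t01; rewrite in_itv.
  have mI := conv_itvoo x1I x0I t0 t1.
  set a := sigma_coef _ _ t _; set b := sigma_coef _ _ (1 - t) _.
  have a0 : (0 <= a)%E by exact: sigma_coef_ge0.
  have b0 : (0 <= b)%E by apply: sigma_coef_ge0 => //; lra.
  (* First translation: it makes the middle point a good parameter for the family [h]. Nothing is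
     asked of the endpoints. *)
  apply: (ae_shifted_le a0 b0 H_good y_c) => // [x xI|].
    by rewrite powR_gt0// Y0.
  move=> e x0eI x1eI meI _ _ Hm; set m := t * x1 + (1 - t) * x0 + e in meI Hm *.
  have yH x : x \in `]0, 1[ -> y x <= y m * H m x `^ al.
    move=> xI; rewrite -powRM; [|exact/ltW/Y0|exact/ltW/H0].
    apply: ge0_ler_powR; first exact: ltW.
    - by rewrite nnegrE ltW ?Y0.
    - by rewrite nnegrE ltW// mulr_gt0 ?Y0 ?H0.
    have [rx rm] := (rho_pos _ xI, rho_pos _ meI).
    have -> : (rho m * L m)^-1 * H m x = (rho x)^-1 * ((1 + (x - m) * z x) / L m).
      by rewrite /H; field; rewrite !gt_eqF.
    (* With [rho x] cancelled, what remains is [L m / L x <= 1 + (x - m) * z x]. *)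
    rewrite invfM ler_pM2l ?invr_gt0// ler_pdivlMr//.
    by rewrite mulrC; exact: L_ratio.
  have hH x : x \in `]0, 1[ -> rho m / rho x = h m x / (1 + (x - m) * z x) ->
      h m x = H m x.
    by move=> xI; rewrite /H => ->; rewrite divfK// gt_eqF// den_gt0.
  have Hle : (a * (H m (x1 + e) `^ al)%:E + b * (H m (x0 + e) `^ al)%:E
      <= (H m m `^ al)%:E)%E.
    (* Second translation: the parameter [m] stays fixed while the three arguments move to points
       where [h m] and [H m] agree. *)
    apply: (@ae_shifted_le _ _ _ (fun x => H m x `^ al) _ _ _ _ a0 b0 Hm) => //.
    - by move=> x xI; apply: (@continuous_powR _ (H m)); [exact: H0|exact: H_c].
    - by move=> x xI; rewrite powR_gt0// H0.
    move=> e' x0I' x1I' mI' /= P0 P1 Pm.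
    rewrite -!hH ?P0 ?P1 ?Pm//.
    have [[_ h_cd] _] := h_CD m meI.
    have sub01 (u : R) : u \in `]0, 1[ -> u \in `[0, 1].
      by rewrite !in_itv/= => /andP[/ltW-> /ltW->].
    have := h_cd _ _ t (sub01 _ x0I') (sub01 _ x1I') t01.
    rewrite /= (_ : x1 + e + e' - (x0 + e + e') = x1 - x0); last ring.
    by rewrite (_ : t * _ + _ = m + e')//; rewrite /m; ring.
  have Hmm : H m m `^ al = 1.
    by rewrite /H subrr mul0r addr0 mulr1 divff ?powR1// gt_eqF// rho_pos.
  have ym0 : (0 <= (y m)%:E)%E by rewrite lee_fin powR_ge0.
  (* Multiplying by [y m] and bounding [y] at both endpoints by [yH] gives the density inequality
     for [y]. *)
  rewrite Hmm in Hle; have := lee_wpmul2l ym0 Hle; rewrite mule1.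
  apply: le_trans; rewrite ge0_muleDr ?mule_ge0 ?lee_fin ?powR_ge0//.
  by apply: leeD; rewrite muleCA -EFinM lee_wpmul2l// lee_fin yH.
- move=> t tI; have rt := rho_pos _ tI.
  by field; rewrite !gt_eqF.
Qed.
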